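(* With the same initial configuration $\mathbb{C}$, Property 6 subsumes Property 3 as a special case, where Property 3 and Property 6 are the two statements about $\mathbb{C}$ given in the context.
   Context: Setting (block relocation problem). There are $S$ stacks and $B$ blocks labelled by $\{1,\dots,B\}$; a smaller label means a higher priority (earlier retrieval). The initial configuration $\mathbb{C}$ places every block in exactly one stack, each stack being a vertical sequence of blocks. Blocks are to be retrieved in the order $1,\dots,B$, a block being retrievable only when it is topmost in its stack; a relocation moves the topmost block of a stack to the top of another stack. The target block is the block of highest priority (block $1$). It is assumed that no block is directly retrievable in $\mathbb{C}$ (block $1$ is not topmost). A block is badly placed (BP) if some block below it in the same stack has a smaller label; otherwise it is well placed (WP). A BG move is a relocation of a BP block after which it is WP; every other relocation is a non-BG move. The priority of a stack is the highest priority (smallest label) of a block in it, and $+\infty$ (the lowest priority) if it is empty. The top $k$-th layer consists of the $k$-th block from the top of each stack (defined when every stack has at least $k$ blocks); the top $k$ layers consist of all blocks of the top $1$st, ..., $k$-th layers. Property 3: at least one non-BG move has to be implemented on a block in each of the top $k$ layers, if (1) the target block is not in the top $k$ layers, and (2) the highest priority of the BP blocks in the top $k$ layers is lower than the lowest priority of all stacks after removing the top $k-1$ layers. A virtual layer is formed by picking one block from each of the $S$ stacks. A virtual layer satisfies P5 if (1) there exists a block piled below the virtual layer whose priority is higher than the highest priority of the blocks in the virtual layer, and (2) the highest priority of the BP blocks in the virtual layer is lower than the lowest priority of all stacks after removing the blocks above the virtual layer. Property 6: given $k$ non-overlapping virtual layers, each of which satisfies P5, at least $k$ non-BG moves will be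 implemented on blocks of those virtual layers. *)

(* Defs.v *)
From mathcomp Require Import all_boot.
Set Implicit Arguments.
Unset Strict Implicit.
Unset Printing Implicit Defensive.

(** Priorities: [Some b] is the priority of label [b], [None] is +oo.
    Smaller labels are higher priorities; [None] is the lowest priority. *)

Definition priority := option nat.

Definition higher (p q : priority) : bool :=
  match p, q with
  | Some a, Some b => a < b
  | Some _, None => true
  | None, _ => false
  end.

(** [None] on the empty sequence. *)
Definition highest (bs : seq nat) : priority :=
  foldr (fun b p => if higher (Some b) p then Some b else p) None bs.

(** The default [Some 0] is higher than every label, labels being positive; it
    is the value only when there is no stack at all. *)
Definition lowest (ps : seq priority) : priority :=
  foldr (fun p q => if higher q p then p else q) (Some 0) ps.

(** Each stack is listed from top to bottom. *)
Definition config (S : nat) := {ffun 'I_S -> seq nat}.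

Section Config.
Variable S : nat.
Implicit Types (C : config S) (s t : 'I_S) (b k : nat).

Definition blocks C : seq nat := flatten [seq C s | s <- enum 'I_S].

Definition initial_config (B : nat) C : Prop := perm_eq (blocks C) (iota 1 B).

Definition target : nat := 1.

Definition none_retrievable C : Prop := forall s, ohead (C s) <> Some target.

Definition below b (st : seq nat) : seq nat := drop (index b st).+1 st.

Definition badly_placed C b : bool :=
  [exists s, (b \in C s) && has (fun c => c < b) (below b (C s))].

Definition well_placed C b : bool := (b \in blocks C) && ~~ badly_placed C b.

Definition stack_priority C s : priority := highest (C s).

Definition lowest_stack_priority C : priority :=
  lowest [seq stack_priority C s | s <- enum 'I_S].

(** Relocations and retrievals.  The block to be retrieved next is the
    remaining block of smallest label, so retrievals occur in the order
    1, ..., B.  A retrieval may be postponed. *)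

Inductive move := Relocate of 'I_S & 'I_S | Retrieve of 'I_S.

Definition set_stack C s (st : seq nat) : config S :=
  [ffun u => if u == s then st else C u].

(** [None] when the move is not allowed. *)
Definition step C (m : move) : option (config S) :=
  match m with
  | Relocate s t =>
      if C s is b :: st then
        if s != t then Some (set_stack (set_stack C s st) t (b :: C t)) else None
      else None
  | Retrieve s =>
      if C s is b :: st then
        if all (leq b) (blocks C) then Some (set_stack C s st) else None
      else None
  end.

Fixpoint solution C (ms : seq move) : bool :=
  if ms is m :: ms' then
    if step C m is Some C' then solution C' ms' else false
  else blocks C == [::].

Definition relocated_block C (m : move) : option nat :=
  if m is Relocate s _ then ohead (C s) else None.

(** The blocks on which the non-BG moves of [ms] are implemented, one entry
    per non-BG move. *)
Fixpoint nonBG_moves C (ms : seq move) : seq nat :=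
  if ms is m :: ms' then
    if step C m is Some C' then
      let rest := nonBG_moves C' ms' in
      if relocated_block C m is Some b then
        if badly_placed C b && well_placed C' b then rest else b :: rest
      else rest
    else [::]
  else [::].

(** A (virtual) layer is given by the block it picks in each stack. *)
Definition layer := {ffun 'I_S -> nat}.
Implicit Type L : layer.

(** The layers are numbered from 1; meaningful when every stack has at least
    [k] blocks. *)
Definition top_layer C k : layer := [ffun s => nth 0 (C s) k.-1].

Definition top_layers C k : seq nat :=
  flatten [seq codom (top_layer C i) | i <- iota 1 k].

Definition remove_top C k : config S := [ffun s => drop k (C s)].

Definition property3_hyp C k : Prop :=
  [/\ 0 < k, forall s, k <= size (C s),
      target \notin top_layers C k
    & higher (lowest_stack_priority (remove_top C k.-1))
             (highest [seq b <- top_layers C k | badly_placed C b])].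

Definition property3 C : Prop :=
  forall k, property3_hyp C k ->
  forall ms, solution C ms ->
  forall i, 1 <= i <= k ->
  exists2 b, b \in codom (top_layer C i) & b \in nonBG_moves C ms.

Definition virtual_layer C L : Prop := forall s, L s \in C s.

Definition remove_above C L : config S :=
  [ffun s => drop (index (L s) (C s)) (C s)].

Definition P5 C L : Prop :=
  (exists s b, b \in below (L s) (C s) /\ higher (Some b) (highest (codom L))) /\
  higher (lowest_stack_priority (remove_above C L))
         (highest [seq b <- codom L | badly_placed C b]).

Definition non_overlapping k (Ls : 'I_k -> layer) : Prop :=
  forall i j, i != j -> forall b, b \in codom (Ls i) -> b \notin codom (Ls j).

Definition property6_hyp C k (Ls : 'I_k -> layer) : Prop :=
  [/\ forall i, virtual_layer C (Ls i), non_overlapping Ls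
    & forall i, P5 C (Ls i)].

Definition property6 C : Prop :=
  forall k (Ls : 'I_k -> layer), property6_hyp C Ls ->
  forall ms, solution C ms ->
  k <= count (fun b => [exists i, b \in codom (Ls i)]) (nonBG_moves C ms).

(** The first [k] top layers, as a family of virtual layers. *)
Definition top_layer_family C k : 'I_k -> layer := fun i => top_layer C i.+1.

End Config.

(* Main.v *)
Require Import Defs.
From mathcomp Require Import all_boot.

Set Implicit Arguments.
Unset Strict Implicit.
Unset Printing Implicit Defensive.

(** A top layer is a virtual layer.  When Property 3 applies to the top [k]
    layers, each layer [i <= k] satisfies P5: the target lies below it, and
    removing fewer layers can only raise the stack priorities, while looking at
    fewer badly placed blocks can only lower their highest priority.  Applying
    Property 6 to the single layer [i], rather than to all [k] layers at once,
    produces a non-BG move on that very layer. *)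

(** The conjunct [p != None] covers empty [bs], where the highest priority is +oo and only a finite
    [p] is strictly higher. This lemma and the next two turn comparisons with an extremum into [all]
    or [has] over a list, so that monotonicity becomes list inclusion. *)
Lemma higher_highest p bs :
  higher p (highest bs) = (p != None) && all (fun b => higher p (Some b)) bs.
Proof.
elim: bs => [|b bs IH] /=; first by case: p.
case: p IH => [a|] //=.
case: (highest bs) => [c|] /= IH; last by rewrite -IH andbT.
rewrite -IH; case: ltnP => [bc|cb] /=.
  by apply/idP/andP => [ab|[]//]; split=> //; apply: ltn_trans bc.
by apply/idP/andP => [ac|[]//]; split=> //; apply: leq_trans cb.
Qed.

Lemma highest_higher bs q :
  higher (highest bs) q = has (fun b => higher (Some b) q) bs.
Proof.
elim: bs => [//|b bs /= <-].
case: (highest bs) q => [c|] [d|] /=; rewrite ?orbF ?orbT //; case: ltnP => //.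
  by move=> bc; apply/idP/orP => [|[//|]]; [left | apply: ltn_trans].
by move=> cb; apply/idP/orP => [|[|//]]; [right | apply: leq_ltn_trans].
Qed.

(** The conjunct [higher (Some 0) q] accounts for empty [ps], where [lowest] takes its default
    [Some 0]. *)
Lemma lowest_higher ps q :
  higher (lowest ps) q = higher (Some 0) q && all (fun p => higher p q) ps.
Proof.
elim: ps => [|p ps IH] /=; first by rewrite andbT.
rewrite andbCA -IH.
case: (lowest ps) p q {IH} => [c|] [a|] [d|] //=; rewrite ?andbF //=; case: ltnP => //=.
  by move=> ca; apply/idP/andP => [ad|[]//]; split=> //; apply: ltn_trans ad.
by move=> ac; apply/idP/andP => [cd|[]//]; split=> //; apply: leq_ltn_trans cd.
Qed.

Section FlattenMap.
Variables (I T : eqType) (F : I -> seq T) (r : seq I).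
Hypothesis Fu : uniq (flatten [seq F i | i <- r]).

Lemma flatten_map_uniq i : i \in r -> uniq (F i).
Proof.
elim: r Fu => [//|j r' IH] /=; rewrite cat_uniq inE => /and3P[Fj _ Fr'].
by case/predU1P => [->//|]; apply: IH.
Qed.

Lemma flatten_map_disjoint i j x :
  i \in r -> j \in r -> x \in F i -> x \in F j -> i = j.
Proof.
elim: r Fu => [//|l r' IH] /=; rewrite cat_uniq !inE => /and3P[_ /hasPn dis Fr'].
have notin h : h \in r' -> x \in F h -> x \notin F l.
  by move=> hr xh; apply: dis; apply/flatten_mapP; exists h.
move=> /predU1P[->|ir] /predU1P[->|jr] xi xj //.
- by have := notin j jr xj; rewrite xi.
- by have := notin i ir xi; rewrite xj.
- exact: IH.
Qed.

End FlattenMap.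

Section TopLayers.
Variables (S B : nat) (C : config S).
Hypothesis hC : initial_config B C.

Lemma blocks_uniq : uniq (blocks C).
Proof. by rewrite (perm_uniq hC) iota_uniq. Qed.

Lemma stack_uniq s : uniq (C s).
Proof. by apply: (flatten_map_uniq blocks_uniq); rewrite mem_enum. Qed.

Lemma stack_inj s t b : b \in C s -> b \in C t -> s = t.
Proof. by apply: (flatten_map_disjoint blocks_uniq); rewrite mem_enum. Qed.

Lemma block_gt0 s b : b \in C s -> 0 < b.
Proof.
move=> bs; have : b \in blocks C.
  by apply/flatten_mapP; exists s; rewrite ?mem_enum.
by rewrite (perm_mem hC) mem_iota => /andP[].
Qed.

Lemma top_layer_virtual i :
  0 < i -> (forall s, i <= size (C s)) -> virtual_layer C (top_layer C i).
Proof. by case: i => // i _ hs s; rewrite ffunE mem_nth. Qed.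

Lemma top_layer_overlap i j b :
  0 < i -> (forall s, i <= size (C s)) ->
  0 < j -> (forall s, j <= size (C s)) ->
  b \in codom (top_layer C i) -> b \in codom (top_layer C j) -> i = j.
Proof.
move=> i0 hi j0 hj /codomP[s ->] /codomP[t e].
(* A shared block lies in only one stack, and occurs there at only one depth. *)
have st : s = t.
  by apply: (stack_inj (top_layer_virtual i0 hi s)); rewrite e top_layer_virtual.
move: e; rewrite -{t}st !ffunE => /eqP.
by rewrite nth_uniq ?stack_uniq ?prednK // => /eqP/(congr1 succn); rewrite !prednK.
Qed.

Lemma index_top_layer i s :
  0 < i -> i <= size (C s) -> index (top_layer C i s) (C s) = i.-1.
Proof. by case: i => // i _ hi; rewrite ffunE index_uniq ?stack_uniq. Qed.

Lemma remove_above_top_layer i :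
  0 < i -> (forall s, i <= size (C s)) ->
  remove_above C (top_layer C i) = remove_top C i.-1.
Proof. by move=> i0 hi; apply/ffunP => s; rewrite [LHS]ffunE [RHS]ffunE index_top_layer. Qed.

Lemma mem_top_layers k i b :
  0 < i <= k -> b \in codom (top_layer C i) -> b \in top_layers C k.
Proof.
by move=> ik bi; apply/flatten_mapP; exists i; rewrite // mem_iota add1n ltnS.
Qed.

Lemma lowest_stack_priority_remove_top i k q :
  i <= k -> higher (lowest_stack_priority (remove_top C k)) q ->
  higher (lowest_stack_priority (remove_top C i)) q.
Proof.
move=> ik; rewrite !lowest_higher => /andP[-> /=] /allP hk.
apply/allP => _ /mapP[s sS ->].
have := hk _ (map_f _ sS); rewrite /stack_priority !highest_higher !ffunE.
(* [drop k] of a stack is a suffix of [drop i], so the block of priority higher than [q] is still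
   present. *)
case/hasP => b; rewrite -(subnK ik) -drop_drop => /mem_drop bi hb.
by apply/hasP; exists b.
Qed.

Lemma property3_hyp_P5 k i :
  0 < B -> property3_hyp C k -> 0 < i <= k -> P5 C (top_layer C i).
Proof.
move=> B0 [k0 hk tk hlow] /[dup] ik0 /andP[i0 ik].
have hi s : i <= size (C s) by apply: leq_trans (hk s).
split.
  have : target \in blocks C by rewrite (perm_mem hC) mem_iota add1n ltnS.
  case/flatten_mapP => s _ ts; exists s, target; split.
    rewrite /below index_top_layer // prednK //.
    (* Were the target among the first [i] blocks, at index [j < i], it would belong to layer
       [j.+1 <= k], against [tk]. *)
    move: ts; rewrite -{1}(cat_take_drop i (C s)) mem_cat => /orP[|//].
    case/(nthP 0) => j; rewrite size_takel // => ji; rewrite nth_take // => tj.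
    case/negP: tk; apply: (@mem_top_layers _ j.+1); first exact: leq_trans ik.
    by apply/codomP; exists s; rewrite ffunE.
  (* The target is label 1: every block of the layer has a positive label and differs from the
     target, hence is larger. *)
  rewrite higher_highest /=; apply/allP => b bi.
  rewrite /= ltn_neqAle; apply/andP; split.
    by apply: contraNneq tk => ->; apply: mem_top_layers bi.
  by case/codomP: bi => t ->; apply: (block_gt0 (s := t)); apply: top_layer_virtual.
rewrite remove_above_top_layer //.
apply: (@lowest_stack_priority_remove_top _ k.-1).
  by rewrite -ltnS !prednK.
move: hlow; rewrite !higher_highest => /andP[-> /=] /allP h.
apply/allP => b; rewrite mem_filter => /andP[bp bi].
by apply: h; rewrite mem_filter bp; apply: mem_top_layers bi.
Qed.

End TopLayers.

Theorem corollary2 (S B : nat) (C : config S) (hB : 0 < B)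
  (hC : initial_config B C) (hR : none_retrievable C) :
  (forall k : nat, property3_hyp C k ->
     property6_hyp C (@top_layer_family S C k)) /\
  (property6 C -> property3 C).
Proof.
split=> [k h3|p6 k h3 ms sol i /[dup] ik0 /andP[i0 ik]].
  have [_ hk _ _] := h3.
  (* Index [i : 'I_k] starts at 0 and stands for layer [i.+1]. *)
  have hi (i : 'I_k) s : i < size (C s) by apply: leq_trans (hk s).
  split=> [i|i j ij b bi|i].
  - exact: top_layer_virtual.
  - apply: contra ij => bj.
    by have [e] := top_layer_overlap hC (ltn0Sn i) (hi i) (ltn0Sn j) (hi j) bi bj; apply/eqP/val_inj.
  - by apply: (property3_hyp_P5 hC hB h3); rewrite /=.
have [_ hk _ _] := h3.
have h6 : property6_hyp C (fun _ : 'I_1 => top_layer C i).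
  split=> [_|j l|_]; last exact: (property3_hyp_P5 hC hB h3 ik0).
    by apply: top_layer_virtual => // s; apply: leq_trans (hk s).
  (* ['I_1] has no two distinct indices, so non-overlap is vacuous. *)
  by rewrite !ord1 eqxx.
(* For one layer, a count of at least 1 is exactly a non-BG move on a block of layer [i]. *)
have := p6 _ _ h6 _ sol; rewrite -has_count => /hasP[b bms /existsP[_ bi]].
by exists b.
Qed.
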